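(* Let $\Omega_c$ be a commutative semigroup and let $(A,\prec_{\omega_1,\omega_2},\succ_{\omega_1,\omega_2},\Omega_c)$ be an $\Omega_c$-relative pre-anti-flexible algebra. For all $\alpha,\beta\in\Omega_c$ and $x,y\in A$ define $$x\blacktriangleright_{\alpha,\beta}y = x\succ_{\alpha,\beta}y - y\prec_{\beta,\alpha}x .$$ Then $(A,\blacktriangleright_{\alpha,\beta},\Omega_c)$ is an $\Omega_c$-relative pre-Lie algebra.
   Context: Standing conventions: $\Omega_c$ is a commutative associative semigroup; $A$ is a finite-dimensional vector space over a field of characteristic zero; all operations on $A$ are bilinear. An $\Omega_c$-relative pre-anti-flexible algebra is a vector space $A$ with bilinear operations $\prec_{\alpha,\beta},\succ_{\alpha,\beta}:A\times A\to A$ for each $(\alpha,\beta)\in\Omega_c^2$ such that for all $x,y,z\in A$ and $\alpha,\beta,\gamma\in\Omega_c$: $$(x\succ_{\alpha,\beta}y)\prec_{\alpha\beta,\gamma}z - x\succ_{\alpha,\beta\gamma}(y\prec_{\beta,\gamma}z) = (z\succ_{\gamma,\beta}y)\prec_{\gamma\beta,\alpha}x - z\succ_{\gamma,\beta\alpha}(y\prec_{\beta,\alpha}x),$$ $$(x\prec_{\alpha,\beta}y + x\succ_{\alpha,\beta}y)\succ_{\alpha\beta,\gamma}z - x\succ_{\alpha,\beta\gamma}(y\succ_{\beta,\gamma}z) = (z\prec_{\gamma,\beta}y)\prec_{\gamma\beta,\alpha}x - z\prec_{\gamma,\beta\alpha}(y\prec_{\beta,\alpha}x + y\succ_{\beta,\alpha}x).$$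 An $\Omega_c$-relative pre-Lie algebra is a vector space $A$ with bilinear operations $\ast_{\alpha,\beta}$ for each $(\alpha,\beta)\in\Omega_c^2$ such that for all $x,y,z\in A$ and $\alpha,\beta,\gamma\in\Omega_c$: $$(x\ast_{\alpha,\beta}y)\ast_{\alpha\beta,\gamma}z - x\ast_{\alpha,\beta\gamma}(y\ast_{\beta,\gamma}z) = (y\ast_{\beta,\alpha}x)\ast_{\beta\alpha,\gamma}z - y\ast_{\beta,\alpha\gamma}(x\ast_{\alpha,\gamma}z).$$ *)

(* Defs.v *)
From HB Require Import structures.
From mathcomp Require Import all_boot all_order all_algebra.
From mathcomp Require Import sesquilinear.

Set Implicit Arguments.
Unset Strict Implicit.
Unset Printing Implicit Defensive.

Import GRing.Theory.
Local Open Scope ring_scope.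

(* The commutative semigroup is given by its law [mu] on an arbitrary type; no
   decidability of equality and no identity element is assumed. *)

Record is_relative_pre_anti_flexible (K : fieldType) (A : lmodType K)
    (Omega : Type) (mu : SemiGroup.com_law Omega)
    (prec succ : Omega -> Omega -> A -> A -> A) : Prop := {
  prec_bilinear : forall a b : Omega, bilinear_for *:%R *:%R (prec a b);
  succ_bilinear : forall a b : Omega, bilinear_for *:%R *:%R (succ a b);
  pre_anti_flexible_middle : forall (a b c : Omega) (x y z : A),
    prec (mu a b) c (succ a b x y) z - succ a (mu b c) x (prec b c y z)
    = prec (mu c b) a (succ c b z y) x - succ c (mu b a) z (prec b a y x);
  pre_anti_flexible_outer : forall (a b c : Omega) (x y z : A),
    succ (mu a b) c (prec a b x y + succ a b x y) z
      - succ a (mu b c) x (succ b c y z)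
    = prec (mu c b) a (prec c b z y) x
      - prec c (mu b a) z (prec b a y x + succ b a y x)
}.

Record is_relative_pre_Lie (K : fieldType) (A : lmodType K)
    (Omega : Type) (mu : SemiGroup.com_law Omega)
    (ast : Omega -> Omega -> A -> A -> A) : Prop := {
  ast_bilinear : forall a b : Omega, bilinear_for *:%R *:%R (ast a b);
  pre_Lie_identity : forall (a b c : Omega) (x y z : A),
    ast (mu a b) c (ast a b x y) z - ast a (mu b c) x (ast b c y z)
    = ast (mu b a) c (ast b a y x) z - ast b (mu a c) y (ast a c x z)
}.

Definition blacktriangleright (K : fieldType) (A : lmodType K) (Omega : Type)
    (prec succ : Omega -> Omega -> A -> A -> A)
    (a b : Omega) (x y : A) : A :=
  succ a b x y - prec b a y x.

(* Main.v *)
(** Write [x > y] for [blacktriangleright]. Expanding the associator of [>] and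
    using the outer identity to eliminate [succ (succ x y) z] leaves
    [prec (succ y z) x + succ x (prec z y)] up to terms that are visibly
    symmetric in [x] and [y]; the middle identity for [(y, z, x)] says that this
    remaining part is symmetric too. *)
Require Import Defs.
From HB Require Import structures.
From mathcomp Require Import all_boot all_order all_algebra.
From mathcomp Require Import sesquilinear.
Set Implicit Arguments.
Unset Strict Implicit.
Unset Printing Implicit Defensive.
Import GRing.Theory.
Local Open Scope ring_scope.

Lemma bilinear_for_addl (K : fieldType) (A : lmodType K) (f : A -> A -> A)
    (f_bilin : bilinear_for *:%R *:%R f) (z : A) :
  {morph f^~ z : x y / x + y}.
Proof. by move=> x y; have := f_bilin.1 z 1 x y; rewrite /= !scale1r. Qed.

Lemma bilinear_for_subl (K : fieldType) (A : lmodType K) (f : A -> A -> A)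
    (f_bilin : bilinear_for *:%R *:%R f) (z : A) :
  {morph f^~ z : x y / x - y}.
Proof. exact: (zmod_morphism_linear (f_bilin.1 z)). Qed.

Lemma bilinear_for_addr (K : fieldType) (A : lmodType K) (f : A -> A -> A)
    (f_bilin : bilinear_for *:%R *:%R f) (z : A) :
  {morph f z : x y / x + y}.
Proof. by move=> x y; have := f_bilin.2 z 1 x y; rewrite /= !scale1r. Qed.

Lemma bilinear_for_subr (K : fieldType) (A : lmodType K) (f : A -> A -> A)
    (f_bilin : bilinear_for *:%R *:%R f) (z : A) :
  {morph f z : x y / x - y}.
Proof. exact: (zmod_morphism_linear (f_bilin.2 z)). Qed.

Lemma blacktriangleright_bilinear (K : fieldType) (A : lmodType K)
    (Omega : Type) (prec succ : Omega -> Omega -> A -> A -> A) (a b : Omega) :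
    bilinear_for *:%R *:%R (prec b a) -> bilinear_for *:%R *:%R (succ a b) ->
  bilinear_for *:%R *:%R (blacktriangleright prec succ a b).
Proof.
move=> prec_bilin succ_bilin.
split=> z k x y; rewrite /blacktriangleright /=.
  by rewrite (succ_bilin.1 z k x y) (prec_bilin.2 z k x y) scalerBr opprD addrACA.
by rewrite (succ_bilin.2 z k x y) (prec_bilin.1 z k x y) scalerBr opprD addrACA.
Qed.

(** Expansion gives eight terms. Trading [succ (succ x y) z] for the other five terms of the outer
    identity makes twelve, six of which cancel in pairs. The grouping puts in the subtracted bracket
    what is invariant under exchanging [(a, x)] with [(b, y)]. *)
Lemma blacktriangleright_associator (K : fieldType) (A : lmodType K)
    (Omega : Type) (mu : SemiGroup.com_law Omega)
    (prec succ : Omega -> Omega -> A -> A -> A) (a b c : Omega) (x y z : A) :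
    is_relative_pre_anti_flexible mu prec succ ->
  blacktriangleright prec succ (mu a b) c
      (blacktriangleright prec succ a b x y) z
    - blacktriangleright prec succ a (mu b c) x
        (blacktriangleright prec succ b c y z)
  = prec (mu b c) a (succ b c y z) x + succ a (mu b c) x (prec c b z y)
    - (succ (mu a b) c (prec a b x y + prec b a y x) z
       + prec c (mu a b) z (succ a b x y + succ b a y x)).
Proof.
move=> hA; have [precB succB _ outer] := hA.
have := outer a b c x y z.
(* The outer identity reverses the index order on its right side; commutativity of [mu] aligns these
   indices with those of the associator. *)
rewrite [mu c b]SemiGroup.opC [mu b a]SemiGroup.opC.
rewrite /blacktriangleright.
rewrite !(bilinear_for_subl (precB _ _), bilinear_for_subr (precB _ _)).
rewrite !(bilinear_for_subl (succB _ _), bilinear_for_subr (succB _ _)).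
rewrite !(bilinear_for_addl (succB _ _), bilinear_for_addr (precB _ _)).
(* The outer identity is solved for [succ (mu a b) c (succ a b x y) z]. *)
move/(canRL (subrK _))/(canRL (addKr _)) => ->.
rewrite !(opprD, opprK) !addrA.
(* The last three groups pair each summand with its opposite. *)
rewrite [LHS](ACl (11*10*1*6*7*4*(2*12)*(8*3)*(5*9))%AC) /=.
by rewrite !subrr !addr0.
Qed.

Theorem theorem3p5 (K : fieldType) (charK0 : [pchar K] =i pred0)
    (A : vectType K) (Omega : Type) (mu : SemiGroup.com_law Omega)
    (prec succ : Omega -> Omega -> A -> A -> A)
    (hA : is_relative_pre_anti_flexible mu prec succ) :
  is_relative_pre_Lie mu (blacktriangleright prec succ).
Proof.
have [precB succB middle _] := hA.
split=> [a b|a b c x y z]; first exact: blacktriangleright_bilinear.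
rewrite !(blacktriangleright_associator _ _ _ _ _ _ hA).
rewrite [mu b a]SemiGroup.opC; congr (_ - _); last first.
  by congr (succ _ _ _ _ + prec _ _ _ _); rewrite addrC.
(* The middle identity exchanges its two outer arguments, so [z] goes in the middle to exchange [x]
   and [y]. *)
have := middle b c a y z x.
rewrite [mu c b]SemiGroup.opC [mu c a]SemiGroup.opC.
move/(canRL (subrK _)) => ->.
by rewrite addrAC subrK.
Qed.
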